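(* Let $G$ be a simple graph, let $f : V(G) \to \mathbb{Z}_{\ge 2}$ be a function, and let $d = \max\{\Delta_f(G), a(G)\}$. If $G$ has girth $g \ge 4d$, then $a_f(G) \le d + 1$.
   Context: For a graph $G$ and a function $f : V(G) \to \mathbb{Z}_{\ge 2}$, a degree-$f$ forest of $G$ is a spanning subgraph that is a forest in which every vertex $v$ has degree at most $f(v)$. The degree-$f$ arboricity $a_f(G)$ is the minimum number of colors in an edge-coloring of $G$ in which every color class is a degree-$f$ forest. The arboricity $a(G)$ is the minimum number of colors in an edge-coloring of $G$ in which every color class is a forest. $\Delta_f(G) = \max_{v \in V(G)} \lceil d(v)/f(v) \rceil$, where $d(v)$ is the degree of $v$. The girth is the length of a shortest cycle (infinite if $G$ is a forest). *)

(* Defs.v *)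
From mathcomp Require Import all_boot.

Set Implicit Arguments.
Unset Strict Implicit.
Unset Printing Implicit Defensive.

(* A simple graph with vertex set [T]; fixing [T] makes every [sgraph T] whose
   edges are edges of [G] a spanning subgraph of [G : sgraph T]. *)
Record sgraph (T : finType) := SGraph {
  adj :> rel T;
  adj_sym : symmetric adj;
  adj_irr : irreflexive adj }.

Section Graph.
Variables (T : finType) (G : sgraph T).

Definition degree (v : T) : nat := #|[set w | G v w]|.

(* The lower bound on the size excludes the sequences [::] and [:: x; y] that
   [ucycleb] accepts. *)
Definition is_cycle (p : seq T) : bool := ucycleb G p && (3 <= size p).

Definition has_cycle (n : nat) : bool := [exists p : n.-tuple T, is_cycle p].

(* Cycles have no repeated vertex, so the bound on their length is harmless
   (see [is_forestP]); it makes the predicate boolean. *)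
Definition is_forest : bool := [forall n : 'I_#|T|.+1, ~~ has_cycle n].

(* [None] stands for infinite girth. *)
Definition girth : option nat :=
  if [pick n : 'I_#|T|.+1 | has_cycle n] is Some n0
  then Some (val [arg min_(n < n0 | has_cycle n) (n : nat)]) else None.

Definition edges : {set {set T}} :=
  [set A : {set T} | [exists x, exists y, G x y && (A == [set x; y])]].

Definition edge := {A : {set T} | A \in edges}.

Lemma has_cycleP n :
  reflect (exists2 p, is_cycle p & size p = n) (has_cycle n).
Proof.
apply: (iffP existsP) => [[p cp]|[p cp sp]].
  by exists p; rewrite ?size_tuple.
by subst n; exists (in_tuple p).
Qed.

Lemma size_is_cycle p : is_cycle p -> size p < #|T|.+1.
Proof.
by case/andP=> /andP[_ up] _; rewrite ltnS -(card_uniqP up) max_card.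
Qed.

Lemma is_forestP : reflect (forall p, ~~ is_cycle p) is_forest.
Proof.
apply: (iffP forallP) => [noc p|noc n].
  apply/negP=> cp; have /negP[] := noc (Ordinal (size_is_cycle cp)).
  by apply/has_cycleP; exists p.
by apply/has_cycleP=> -[p cp _]; move: (noc p); rewrite cp.
Qed.

Lemma girth_Some g : girth = Some g <->
  (exists2 p, is_cycle p & size p = g) /\
  (forall p, is_cycle p -> g <= size p).
Proof.
rewrite /girth; case: pickP => [n0 cn0|noc].
  case: arg_minnP => // m cm min_m; split=> [[<-]|[[p cp sp] min_g]].
    split=> [|p cp]; first exact/has_cycleP.
    by apply: (min_m (Ordinal (size_is_cycle cp))); apply/has_cycleP; exists p.
  have [q cq sq] := has_cycleP _ cm; congr Some; apply/eqP.
  rewrite eqn_leq /= -{2}sq min_g // andbT -sp.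
  by apply: (min_m (Ordinal (size_is_cycle cp))); apply/has_cycleP; exists p.
split=> // -[[p cp _] _].
have /has_cycleP[] := noc (Ordinal (size_is_cycle cp)).
by exists p.
Qed.

Lemma girth_None : girth = None <-> is_forest.
Proof.
rewrite /girth; case: pickP => [n0 cn0|noc]; split=> //.
  by move/forallP/(_ n0); rewrite cn0.
by move=> _; apply/forallP=> n; rewrite noc.
Qed.

Definition color_adj k (c : {ffun edge -> 'I_k}) (i : 'I_k) : rel T :=
  fun x y => [exists a : edge, (val a == [set x; y]) && (c a == i)].

Lemma color_adj_sym k (c : {ffun edge -> 'I_k}) i : symmetric (color_adj c i).
Proof. by move=> x y; rewrite /color_adj setUC. Qed.

Lemma color_adjW k (c : {ffun edge -> 'I_k}) i x y : color_adj c i x y -> G x y.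
Proof.
case/existsP=> -[A EA] /andP[/eqP/= defA _]; move: EA; rewrite {A}defA inE.
case/existsP=> u /existsP[v /andP[Guv /eqP Euv]].
have uNv : u != v by apply: contraTneq Guv => ->; rewrite adj_irr.
have /set2P xuv : x \in [set u; v] by rewrite -Euv set21.
have /set2P yuv : y \in [set u; v] by rewrite -Euv set22.
have := set21 u v; have := set22 u v; rewrite -Euv !inE.
case: xuv yuv => -> [] -> //; rewrite ?orbb 1?(adj_sym G v u) //.
  by rewrite eq_sym (negPf uNv).
by rewrite (negPf uNv).
Qed.

Lemma color_adj_irr k (c : {ffun edge -> 'I_k}) i : irreflexive (color_adj c i).
Proof.
by move=> x; apply: contraFF (adj_irr G x); apply: color_adjW.
Qed.

Definition color_class k (c : {ffun edge -> 'I_k}) (i : 'I_k) : sgraph T :=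
  SGraph (color_adj_sym c i) (@color_adj_irr k c i).

End Graph.

Section Arboricity.
Variable T : finType.

Definition is_deg_forest (f : T -> nat) (H : sgraph T) : bool :=
  is_forest H && [forall v, degree H v <= f v].

Definition forest_colorable (G : sgraph T) (k : nat) : bool :=
  [exists c : {ffun edge G -> 'I_k}, [forall i, is_forest (color_class c i)]].

Definition deg_forest_colorable (f : T -> nat) (G : sgraph T) (k : nat) : bool :=
  [exists c : {ffun edge G -> 'I_k},
    [forall i, is_deg_forest f (color_class c i)]].

Lemma ex_deg_forest_colorable (f : T -> nat) (G : sgraph T) :
  (forall v, 2 <= f v) -> exists k, deg_forest_colorable f G k.
Proof.
move=> f_ge2; exists #|{: edge G}|; apply/existsP; exists (finfun enum_rank).
apply/forallP=> i.
have one x y z : color_adj (finfun enum_rank) i x y ->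
    color_adj (finfun enum_rank) i y z -> x = z.
  move=> xy yz; have xNy : x != y.
    by apply: contraTneq xy => ->; rewrite color_adj_irr.
  case/existsP: xy => a /andP[/eqP da]; rewrite ffunE => /eqP ci.
  case/existsP: yz => b /andP[/eqP db]; rewrite ffunE -ci.
  move=> /eqP/enum_rank_inj ab.
  have: x \in [set y; z] by rewrite -db ab da set21.
  by rewrite !inE (negPf xNy) => /eqP.
apply/andP; split; last first.
  apply/forallP=> v; apply: leq_trans (ltnW (f_ge2 v)).
  apply/card_le1_eqP=> x y; rewrite !inE => vx vy.
  by apply: (one y v x _ vx); rewrite color_adj_sym.
apply/is_forestP=> -[|x [|y [|z p]]] //; rewrite /is_cycle /ucycleb.
  by rewrite andbF.
  by rewrite andbF.
apply/negP=> /andP[/andP[/= /and3P[xy yz _] /andP[xN _]] _].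
by move: xN; rewrite (one _ _ _ xy yz) !inE eqxx orbT.
Qed.

Lemma ex_forest_colorable (G : sgraph T) : exists k, forest_colorable G k.
Proof.
have [k /existsP[c /forallP cP]] :=
  @ex_deg_forest_colorable (fun=> 2) G (fun=> leqnn 2).
by exists k; apply/existsP; exists c; apply/forallP=> i; case/andP: (cP i).
Qed.

Definition arboricity (G : sgraph T) : nat := ex_minn (ex_forest_colorable G).

Definition deg_arboricity (G : sgraph T) (f : T -> nat)
    (f_ge2 : forall v, 2 <= f v) : nat :=
  ex_minn (ex_deg_forest_colorable G f_ge2).

(* The ceiling of m / n, for n > 0. *)
Definition ceil_div (m n : nat) : nat := (m + n.-1) %/ n.

Definition max_degree_ratio (G : sgraph T) (f : T -> nat) : nat :=
  \max_(v : T) ceil_div (degree G v) (f v).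

End Arboricity.

(* [n <= g] for [g] in the naturals extended by [None] as infinity. *)
Definition leq_inf (n : nat) (g : option nat) : bool :=
  if g is Some m then n <= m else true.

(* Main.v *)
(* Idea. The d forests give an orientation with outdegrees at most d; reversing
   paths that end in a vertex of too large indegree turns it into one whose
   indegrees are also at most d (f v - 1), since the indegrees in the set of
   vertices reaching that vertex cannot sum to more than its outdegrees. After
   splitting v into one vertex for its outgoing edges and f v - 1 vertices for
   its incoming ones, Konig's edge colouring theorem gives d colour classes with
   outdegree at most 1 and indegree at most f v - 1. The cycles of such a class
   are disjoint circuits, of length at least 4d by the girth hypothesis.

   It remains to take one edge out of each monochromatic circuit so that the
   chosen edges have in- and outdegree at most 1 and contain no circuit: they
   form the last class. This is done by an augmentation argument in the style of
   Haxell's theorem on independent transversals. An edge e is blocked by the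
   chosen edges with the same tail or the same head or, when there are none, by
   the chosen edge leaving the head of e if e would close a circuit. A blocked
   edge together with its k blockers excludes at most 4k sets of at most d edges
   (those with a given tail, or with a given head). With K blockers in all, at
   most 4dK edges are excluded, while the K + 1 circuits reached so far contain
   at least 4d (K + 1) edges, so that the search never gets stuck. *)

Require Import Defs.
From mathcomp Require Import all_boot zify.

Set Implicit Arguments.
Unset Strict Implicit.
Unset Printing Implicit Defensive.

(** * Transversals without circuits *)

Section AcyclicTransversal.
Variables (V E I : finType) (tail head : E -> V) (part : E -> I).
Implicit Types (S T : {set E}) (e t b : E).

Definition arc_rel T : rel V :=
  fun x y => [exists t in T, (tail t == x) && (head t == y)].

Definition closes T e : bool := connect (arc_rel T) (head e) (tail e).

Definition acyclic T : bool := [forall t in T, ~~ closes T t].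

Lemma arc_relP T x y :
  reflect (exists2 t, t \in T & tail t = x /\ head t = y) (arc_rel T x y).
Proof.
apply: (iffP exists_inP) => [[t tT /andP[/eqP ? /eqP ?]]|[t tT [<- <-]]].
  by exists t.
by exists t; rewrite ?eqxx.
Qed.

Lemma closesS S T e : S \subset T -> closes S e -> closes T e.
Proof.
move=> sST; apply: connect_sub => x y /arc_relP[t tS txy]; apply: connect1.
by apply/arc_relP; exists t; first exact: (subsetP sST).
Qed.

Lemma acyclicS S T : S \subset T -> acyclic T -> acyclic S.
Proof.
move=> sST /forall_inP acT; apply/forall_inP=> t tS.
by apply: contra (acT _ (subsetP sST _ tS)); apply: closesS.
Qed.

(** A walk of [e |: T] that uses [e] runs in [T] before its first passage through [e] and after its
    last one. A circuit through [e] therefore yields a walk of [T] from [head e] to [tail e]. *)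
Lemma acyclicU1 T e : acyclic T -> ~~ closes T e -> acyclic (e |: T).
Proof.
move=> /forall_inP acT ncl.
have splitP x y : connect (arc_rel (e |: T)) x y -> connect (arc_rel T) x y \/
    connect (arc_rel T) x (tail e) /\ connect (arc_rel T) (head e) y.
  case/connectP=> p; elim: p x => [x _ ->|z p IHp x /= /andP[xz zp] lp].
    by left.
  case/arc_relP: xz => t /setU1P[->|tT] [tx hz].
    right; rewrite -tx connect0 hz; split=> //.
    by case: (IHp z zp lp) => [|[]]; rewrite ?hz.
  have xz : connect (arc_rel T) x z by apply/connect1/arc_relP; exists t.
  case: (IHp z zp lp) => [zy|[zt hy]]; first by left; apply: connect_trans zy.
  by right; split=> //; apply: connect_trans zt.
apply/forall_inP=> t /setU1P[->|tT]; apply/negP=> /splitP[]; first exact/negP.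
- by case=> het _; rewrite /closes het in ncl.
- exact/negP/acT.
case=> tte eht; case/negP: ncl; apply: connect_trans eht _.
apply: connect_trans tte; apply/connect1/arc_relP; by exists t.
Qed.

Lemma closes_next T e :
  tail e != head e -> closes T e -> exists2 t, t \in T & tail t = head e.
Proof.
move=> loop /connectP[[|z p] /= ]; first by move=> _ te;
  rewrite te eqxx in loop.
by case/andP=> /arc_relP[t tT [tt _]] _ _; exists t.
Qed.

(** * Blockers, costs and threads *)

Definition slots T e := [set t in T | (tail t == tail e) || (head t == head e)].

Definition blockers T e : {set E} :=
  if slots T e != set0 then slots T e else
  if closes T e then [set t in T | tail t == head e] else set0.

(* Closing a circuit costs less than meeting one slot: an edge that loses its
   last slot blocker becomes cheaper even if it then closes a circuit. *)
Definition cost T e : nat :=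
  if slots T e != set0 then #|slots T e|.+1 else closes T e.

(** These are the edge sets of vertex-disjoint directed paths. *)
Definition thread T := [/\ {in T &, injective tail}, {in T &, injective head}
  & acyclic T].

Definition linked e t :=
  [|| tail t == tail e, head t == head e | tail t == head e].

Lemma blockersP T e t : t \in blockers T e -> t \in T /\ linked e t.
Proof.
rewrite /blockers /linked; case: ifP => _.
  by rewrite inE => /andP[-> /orP[]->]; rewrite ?orbT.
by case: ifP => _; rewrite !inE // => /andP[-> ->]; rewrite !orbT.
Qed.

(** If [e] met no slot but closed a circuit, the chosen edge leaving [head e] would block it; hence
    an unblocked edge closes nothing. *)
Lemma threadU1 T e : thread T -> tail e != head e -> blockers T e = set0 ->
  thread (e |: T) /\ slots T e = set0.
Proof.
move=> [tT hT aT] loop; rewrite /blockers.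
case: eqVneq => [s0|sN0] /=; last by move/eqP; rewrite (negPf sN0).
case: ifP => [cl|/negbT ncl _].
  have [t tiT tt] := closes_next loop cl.
  by move/setP/(_ t); rewrite !inE tiT tt eqxx.
have conf t : t \in T -> (tail t == tail e) || (head t == head e) = false.
  by move=> tiT; have := in_set0 t; rewrite -s0 inE tiT.
split=> //; split; last exact: acyclicU1.
- move=> x y /setU1P[->|xT] /setU1P[->|yT] //; last exact: tT.
    by move=> exy; have := conf _ yT; rewrite exy eqxx.
  by move=> exy; have := conf _ xT; rewrite exy eqxx.
- move=> x y /setU1P[->|xT] /setU1P[->|yT] //; last exact: hT.
    by move=> exy; have := conf _ yT; rewrite exy eqxx orbT.
  by move=> exy; have := conf _ xT; rewrite exy eqxx orbT.
Qed.

Lemma threadS S T : S \subset T -> thread T -> thread S.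
Proof.
move=> /[dup]/subsetP sST sub [tT hT aT]; split; last exact: acyclicS aT.
  by move=> x y /sST xT /sST yT; apply: tT.
by move=> x y /sST xT /sST yT; apply: hT.
Qed.

Hypothesis loopless : forall e, tail e != head e.

(** * Stages of the search and exchange of edges *)

Definition transversal (Q : {set I}) T :=
  [/\ thread T, {in T &, injective part} & part @: T = Q].

(* A stage [(e, L)] freezes the blockers [L] of the edge [e]. *)
Fixpoint fits (Q : {set I}) (s : seq (E * {set E})) T : Prop :=
  if s is (e, L) :: s' then fits Q s' T /\ blockers T e = L
  else transversal Q T.

Definition free (s : seq (E * {set E})) e : Prop :=
  forall x L, (x, L) \in s ->
    [/\ tail e != tail x, head e != head x
      & {in L, forall b, [/\ tail e != tail b, head e != head b
                          & head e != tail b]}].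

(** Each stage was added when its edge was as cheap as possible. Minimality is asked of every
    transversal that fits the stage, because the current transversal changes during the search. *)
Fixpoint tight (Q : {set I}) (s : seq (E * {set E})) : Prop :=
  if s is (e, L) :: s' then [/\ tight Q s', L != set0
    & forall S T, fits Q s' S -> fits Q s T -> cost T e <= cost S e]
  else True.

Lemma fits_transversal Q s T : fits Q s T -> transversal Q T.
Proof. by elim: s => //= -[e L] s IHs [/IHs]. Qed.

Lemma fits_blockers Q s T x L : fits Q s T -> (x, L) \in s -> blockers T x = L.
Proof.
elim: s => //= -[e M] s IHs [fT bT]; rewrite inE => /orP[/eqP[-> ->]|] //.
exact: IHs.
Qed.

(** Freeness keeps [e] out of the slots of every frozen edge [x]. If [x] is blocked only by closing
    a circuit, it still closes one after the swap: the new set fits the earlier stages, among which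
    the minimal cost of [x] is 1. *)
Lemma swap_fits Q s T b e : tight Q s -> fits Q s T ->
  transversal Q (e |: T :\ b) -> e \notin T -> free s e ->
  (forall x L, (x, L) \in s -> b \notin L) -> fits Q s (e |: T :\ b).
Proof.
move=> + + trU eT; set U := e |: T :\ b.
elim: s => //= -[x L] s IHs [tis L0 minc] [fT bT] frs bN.
have fU : fits Q s U.
  apply: IHs => // y M yM; first by apply: frs; rewrite inE yM orbT.
  by apply: (bN y); rewrite inE yM orbT.
split=> //; have bL : b \notin L by apply: (bN x); rewrite mem_head.
have [tx hx frL] := frs x L (mem_head _ _).
have slU : slots U x = slots T x :\ b.
  apply/setP=> t; rewrite !inE; case: (eqVneq t e) => [->|_] /=.
    by rewrite (negPf eT) (negPf tx) (negPf hx) /= andbF.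
  by rewrite andbA.
have cst := minc _ T fU (conj fT bT); move: cst bL.
rewrite -{}bT in L0 frL *; rewrite /cost /blockers slU in L0 frL *.
case: (eqVneq (slots T x) set0) L0 frL => /= [->|s0 _ _ _ bs]; last first.
  have -> : slots T x :\ b = slots T x.
    by apply/setDidPl; rewrite disjoint_sym disjoints1.
  by rewrite s0.
rewrite set0D eqxx /=; case: ifP => cT L0 frL; last by rewrite eqxx in L0.
case: (closes U x) => // _.
rewrite inE => bT; apply/setP=> t; rewrite !inE.
case: (eqVneq t e) => [->|_] /=.
  rewrite (negPf eT) /=; case/set0Pn: L0 => u; move=> /[dup] /frL[teu _ _].
  by rewrite inE => /andP[_ /eqP <-]; apply: negPf.
by case: (eqVneq t b) => //= ->; rewrite (negPf bT).
Qed.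

(** Losing one of several slots saves 1, and losing the only one lowers the cost from 2 to at most
    1. A circuit blocker [b] is the only edge of [T] leaving [head x], and [e] does not leave it
    either; so after the swap no circuit can close. *)
Lemma swap_cost T b e x : {in T &, injective tail} -> e \notin T ->
  tail e != tail x -> head e != head x -> b \in blockers T x ->
  tail e != tail b -> cost (e |: T :\ b) x < cost T x.
Proof.
move=> tT eT tx hx; set U := _ |: _.
have slU : slots U x = slots T x :\ b.
  apply/setP=> t; rewrite !inE; case: (eqVneq t e) => [->|_] /=.
    by rewrite (negPf eT) (negPf tx) (negPf hx) /= andbF.
  by rewrite andbA.
rewrite /cost /blockers slU.
case: (eqVneq (slots T x) set0) => /= [->|s0 bs _].
  rewrite set0D eqxx /=; case: ifP => cT; rewrite inE //.
  case/andP=> bT /eqP tb teb; case: (boolP (closes U x)) => //.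
  case/(closes_next (loopless x)) => t.
  case/setU1P=> [->|/setD1P[tNb tiT]] tt.
    by rewrite tt tb eqxx in teb.
  by rewrite (tT t b) ?eqxx ?tt ?tb in tNb.
rewrite [in ltnRHS](cardsD1 b) bs; case: eqVneq => //= _.
by case: (closes U x).
Qed.

(** At the earliest stage whose blockers contain [b], the swap preserves all preceding stages but
    makes the edge of this stage cheaper, against minimality. *)
Lemma swap_absurd Q s T b e : tight Q s -> fits Q s T ->
  transversal Q (e |: T :\ b) -> e \notin T -> free s e ->
  ~ (exists2 x, x \in s & b \in x.2).
Proof.
move=> + + trU eT; elim: s => [|[x L] s IHs] /= => [_ _ _ [] //|].
move=> [tis L0 minc] [fT bT] frs.
have frs' : free s e by move=> y M yM; apply: frs; rewrite inE yM orbT.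
case: (boolP (has (fun x : E * {set E} => b \in x.2) s)) => [/hasP|/hasPn bs].
  by move=> bs _; apply: IHs.
case=> y; rewrite inE => /orP[/eqP->/= bL|/bs/negP]//.
have fU : fits Q s (e |: T :\ b) by apply: swap_fits => // z M /bs.
have [tx hx /(_ _ bL)[teb _ _]] := frs x L (mem_head _ _).
have := minc _ T fU (conj fT bT); rewrite leqNgt swap_cost ?bT //.
by have [[]] := fits_transversal fT.
Qed.

Lemma fits_min Q s T e : fits Q s T ->
  exists2 S, fits Q s S & forall U, fits Q s U -> cost S e <= cost U e.
Proof.
(* A boolean form of [fits] makes the minimum available. *)
have [p pP] : exists p : pred {set E}, forall U, fits Q s U <-> p U.
  elim: s => [|[x L] s [p pP]] /=.
    exists (fun U : {set E} => [&& [&& dinjectiveb tail U, dinjectiveb head U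
      & acyclic U], dinjectiveb part U & part @: U == Q]) => U.
    split=> [[[tU hU aU] pU ->]|/and3P[/and3P[tU hU aU] pU /eqP eQ]].
      by rewrite eqxx andbT aU andbT -andbA; apply/and3P; split;
        apply/dinjectiveP.
    by split=> //; [split=> // | ]; apply/dinjectiveP.
  exists (fun U : {set E} => p U && (blockers U x == L)) => U; rewrite pP.
  by split=> [[-> ->]|/andP[-> /eqP]]; rewrite ?eqxx.
move=> /pP pT; case: (arg_minnP (fun U => cost U e) pT) => S /pP fS minS.
by exists S => // U /pP/minS.
Qed.

(** The ends of a blocker show whether it is a slot, so a nonempty set of blockers determines the
    cost. This passes minimality from one transversal to all those with the same frozen blockers. *)
Lemma blockers_cost S T e : blockers S e = blockers T e ->
  blockers S e != set0 ->
  cost S e = cost T e.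
Proof.
have sub X Y : blockers X e = blockers Y e -> slots Y e = set0 ->
  slots X e = set0.
  move=> eXY Y0; apply/eqP/negPn/negP=> X0; case/set0Pn: (X0) => t tX.
  have := in_set0 t; rewrite -Y0 inE => /negP[].
  move: (tX); rewrite inE => /andP[_ ->]; rewrite andbT.
  suff /blockersP[] : t \in blockers Y e by [].
  by rewrite -eXY /blockers X0.
move=> eST; rewrite /cost; move: (eST); rewrite /blockers.
case: (eqVneq (slots T e) set0) => [T0|T0].
  rewrite (sub S T eST T0) eqxx /= => + S0.
  case: (closes S e) S0; case: (closes T e); rewrite ?eqxx // => S0 eS.
  by rewrite eS eqxx in S0.
case: eqVneq => [S0|S0] /=; last by move->.
by rewrite (sub T S (esym eST) S0) eqxx in T0.
Qed.

(* Edges entering the tail of a frozen blocker are excluded as well: otherwise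
   that blocker could also block, through a circuit, the next edge chosen. *)
Definition dead (s : seq (E * {set E})) e : bool :=
  has (fun x : E * {set E} => (tail e \in tail x.1 |: tail @: x.2)
    || (head e \in head x.1 |: (head @: x.2 :|: tail @: x.2))) s.

Lemma free_dead s e : ~~ dead s e -> free s e.
Proof.
move=> /hasPn ds x L /ds /=; rewrite !inE !negb_or => /and4P[].
case/andP=> -> /= tL -> hL tL'; split=> // b bL; split.
- by apply: contraNneq tL => ->; apply: imset_f.
- by apply: contraNneq hL => ->; apply: imset_f.
- by apply: contraNneq tL' => ->; apply: imset_f.
Qed.

Lemma card_fibers (f : E -> V) d (A : {set V}) :
  (forall v, #|[set e | f e == v]| <= d) -> #|[set e | f e \in A]| <= d * #|A|.
Proof.
move=> fd; rewrite -sum1_card (partition_big f (mem A)) /=; last first.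
  by move=> e; rewrite inE.
rewrite mulnC -sum_nat_const; apply: leq_sum => v vA.
apply: leq_trans (fd v); rewrite -sum1_card; apply: eq_leq.
by apply: eq_bigl => e; rewrite !inE andb_idl // => /eqP->.
Qed.

(** The sets have at most [1 + #|L|] and [1 + 2 * #|L|] elements, enough if [#|L|] is at least 2.
    For a single blocker the total of 5 drops to 4 by the coincidence of ends that links it to
    [x]. *)
Lemma card_slots x L : L != set0 -> {in L, forall b, linked x b} ->
  #|tail x |: tail @: L| + #|head x |: (head @: L :|: tail @: L)| <= 4 * #|L|.
Proof.
move=> L0 lnk; have := leq_imset_card tail L; have := leq_imset_card head L.
have := cardsU1 (tail x) (tail @: L).
have := cardsU1 (head x) (head @: L :|: tail @: L).
have : #|head @: L :|: tail @: L| <= #|head @: L| + #|tail @: L|.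
  exact: leq_card_setU.
have [L2|] := leqP 2 #|L|; first by do 2![case: (_ \notin _)]; lia.
have := L0; rewrite -card_gt0 => L1 L2;
  have /eqP/cards1P[b Lb] : #|L| = 1 by lia.
have := lnk b; rewrite Lb set11 /linked !imset_set1 !inE.
rewrite cards1 => /(_ isT) /or3P[]/eqP->; rewrite eqxx ?orbT /=; lia.
Qed.

Variable d : nat.
Hypothesis tail_le : forall v, #|[set e | tail e == v]| <= d.
Hypothesis head_le : forall v, #|[set e | head e == v]| <= d.

Lemma card_dead Q s T : tight Q s -> fits Q s T ->
  #|[set e | dead s e]| <= 4 * d * \sum_(x <- s) #|x.2|.
Proof.
elim: s => [|[x L] s IHs] /= => [_ _|[ts L0 _] [fT bT]].
  by rewrite big_nil muln0 leqn0 cards_eq0; apply/eqP/setP=> e; rewrite !inE.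
rewrite big_cons mulnDr /=.
set A := tail x |: tail @: L; set B := head x |: (head @: L :|: tail @: L).
have -> : [set e | dead ((x, L) :: s) e] =
    ([set e | tail e \in A] :|: [set e | head e \in B]) :|: [set e | dead s e].
  by apply/setP=> e; rewrite /dead /A /B !inE /= !inE.
apply: leq_trans (leq_card_setU _ _) _; apply: leq_add (IHs ts fT).
apply: leq_trans (leq_card_setU _ _) _.
have := card_fibers A tail_le; have := card_fibers B head_le.
have : #|A| + #|B| <= 4 * #|L|.
  by apply: card_slots => // b; rewrite -bT => /blockersP[].
move=> /(leq_mul (leqnn d)); rewrite mulnDr; lia.
Qed.

Definition reached (a : I) (s : seq (E * {set E})) : {set I} :=
  a |: \bigcup_(x <- s) (part @: x.2).

Lemma extend_stage (Q : {set I}) a s T : 0 < d -> a \notin Q ->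
  {in a |: Q, forall i, 4 * d <= #|[set e | part e == i]|} ->
  tight Q s -> fits Q s T -> #|reached a s| = (\sum_(x <- s) #|x.2|).+1 ->
  exists U, transversal (a |: Q) U.
Proof.
move=> d_gt0 aQ big; have [n] := ubnP (#|I| - #|reached a s|).
elim: n s T => // n IHn s T ltn ts fT cs.
have leaf U i : fits Q s U -> i \in reached a s -> i != a ->
    exists x L b, [/\ (x, L) \in s, b \in L, b \in U & part b = i].
  move=> fU /setU1P[->|]; first by rewrite eqxx.
  rewrite bigcup_seq => /bigcupP[[x L] xs /imsetP[b bL ->] _].
  exists x, L, b; split=> //; move: bL.
  by rewrite /= -(fits_blockers fU xs) => /blockersP[].
have sub : reached a s \subset a |: Q.
  apply/subsetP=> i iR; rewrite !inE; case: eqVneq => //= ia.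
  have [x [L [b [_ _ bT <-]]]] := leaf _ _ fT iR ia.
  by case: (fits_transversal fT) => _ _ <-; apply: imset_f.
have [e eR eD] : exists2 e, part e \in reached a s & ~~ dead s e.
  apply/exists_inP; rewrite -negb_forall_in; apply/negP=> /forall_inP allD.
  have : #|[set e | part e \in reached a s]| <= #|[set e | dead s e]|.
    by apply/subset_leq_card/subsetP=> e; rewrite in_set => /allD;
      rewrite in_set.
  rewrite leqNgt (leq_ltn_trans (card_dead ts fT)) //.
  have : 4 * d * #|reached a s| <= #|[set e | part e \in reached a s]|.
    rewrite -[leqRHS]sum1_card (partition_big part (mem (reached a s))) /=.
      rewrite mulnC -sum_nat_const; apply: leq_sum => i iR.
      apply: leq_trans (big i (subsetP sub _ iR)) _.
      rewrite -sum1_card; apply: eq_leq; apply: eq_bigl => e.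
      by rewrite [RHS]andb_idl ?[LHS]inE // => /eqP pe; rewrite inE pe.
    by move=> e; rewrite in_set.
  by apply: leq_trans; rewrite cs; lia.
have frs := free_dead eD.
have [S fS minS] := fits_min e fT.
have trS := fits_transversal fS; have [thS pS eQ] := trS.
(* The edge of [S] in a reached part other than [a] is a frozen blocker, and the free edge [e]
   shares no tail with those. *)
have eS : part e != a -> e \notin S.
  move=> ea; apply/negP=> eS;
    have [x [L [b [xs bL bS pb]]]] := leaf _ _ fS eR ea.
  have [_ _ /(_ b bL)[]] := frs x L xs.
  by rewrite (pS b e bS eS pb) eqxx.
case: (eqVneq (blockers S e) set0) => [B0|B0].
  have [thU sl] := threadU1 thS (loopless e) B0.
  have eNS : e \notin S.
    by have := in_set0 e; rewrite -sl inE !eqxx andbT => ->.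
  case: (eqVneq (part e) a) => [pe|ea].
    exists (e |: S); split=> //; last by rewrite imsetU1 eQ pe.
    have aS t : t \in S -> part t != part e.
      by move=> tS; apply: contraNneq aQ; rewrite pe -eQ => <-; apply: imset_f.
    move=> x y /setU1P[->|xS] /setU1P[->|yS] //; last exact: pS.
      by move/esym/eqP; rewrite (negPf (aS _ yS)).
    by move/eqP; rewrite (negPf (aS _ xS)).
  have [x [L [b [xs bL bS pb]]]] := leaf _ _ fS eR ea.
  case: (@swap_absurd Q s S b e ts fS _ eNS frs); last by exists (x, L).
  split; first by apply: threadS thU; rewrite setUS // subD1set.
    have bN t : t \in S :\ b -> part t != part e.
      by case/setD1P=> tb tS; rewrite -pb;
        apply: contraNneq tb => /(pS _ _ tS bS)->.
    move=> y z /setU1P[->|yS] /setU1P[->|zS] //.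
    - by move/esym/eqP; rewrite (negPf (bN _ zS)).
    - by move/eqP; rewrite (negPf (bN _ yS)).
    by apply: pS; [case/setD1P: yS | case/setD1P: zS].
  by rewrite imsetU1 -pb -imsetU1 setD1K.
(* A blocker in a reached part would be a frozen one, to which the free edge [e] is not linked. *)
have new t : t \in blockers S e -> part t \notin reached a s.
  case/blockersP=> tS lnk; apply/negP=> tR.
  have ta : part t != a by apply: contraNneq aQ => <-; rewrite -eQ imset_f.
  have [x [L [b [xs bL bS pb]]]] := leaf _ _ fS tR ta.
  have [_ _ /(_ b bL)] := frs x L xs; rewrite (pS b t bS tS pb) => -[] h1 h2 h3.
  move: lnk; rewrite /linked !(eq_sym _ (tail e), eq_sym _ (head e)).
  by rewrite (negPf h1) (negPf h2) (negPf h3).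
have R' : reached a ((e, blockers S e) :: s) =
    part @: blockers S e :|: reached a s.
  by rewrite /reached big_cons /= setUCA.
have cB : #|part @: blockers S e| = #|blockers S e|.
  by apply: card_in_imset => x y /blockersP[xS _] /blockersP[yS _]; apply: pS.
have cR : #|reached a ((e, blockers S e) :: s)| =
    #|blockers S e| + #|reached a s|.
  rewrite R' cardsU -cB; set X := _ :&: _;
    suff -> : X = set0 by rewrite cards0 subn0.
  apply/setP=> i; rewrite !inE; apply/negP=> /andP[/imsetP[t tB ->] tR].
  by have := new t tB; rewrite /reached !inE in tR *; rewrite tR.
apply: (IHn ((e, blockers S e) :: s) S) => //=.
- have := max_card (reached a ((e, blockers S e) :: s)).
  move: B0 ltn; rewrite -card_gt0 cR.
  by move: #|reached a s| #|blockers S e| #|I| => r b i; lia.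
- split=> // U W fU [fW bW]; apply: leq_trans (minS U fU).
  by rewrite (@blockers_cost S W) ?bW.
- by rewrite big_cons /= cR cs addnS.
Qed.

Theorem acyclic_transversal :
  (forall e, 4 * d <= #|[set e' | part e' == part e]|) ->
  exists2 T, thread T & forall e, exists2 t, t \in T & part t = part e.
Proof.
(* Without edges the empty set works; an edge forces [0 < d], which the counting requires. *)
move=> big; case: (pickP (@predT E)) => [e0 _|none]; last first.
  exists set0 => [|e]; last by have := none e.
  by split; [move=> x y; rewrite inE.. | apply/forall_inP=> t; rewrite inE].
have d_gt0 : 0 < d.
  apply: leq_trans (tail_le (tail e0)); apply/card_gt0P; exists e0.
  by rewrite inE eqxx.
suff [T [thT _ QT]] : exists T, transversal (part @: setT) T.
  exists T => // e; have /imsetP[t tT ->] : part e \in part @: T.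
    by rewrite QT imset_f ?inE.
  by exists t.
suff H n : forall Q : {set I}, #|Q| = n -> Q \subset part @: setT ->
  exists T, transversal Q T by apply: H.
elim: n => [Q /cards0_eq -> _|n IHn Q cQ sQ].
  exists set0; split; last exact: imset0; last by move=> x y; rewrite inE.
  by split; [move=> x y; rewrite inE.. | apply/forall_inP=> t; rewrite inE].
have /card_gt0P[a aQ] : 0 < #|Q| by rewrite cQ.
have sD : Q :\ a \subset part @: setT by apply: subset_trans sQ;
  apply: subD1set.
have [|T trT] := IHn (Q :\ a) _ sD; first by move: cQ;
  rewrite (cardsD1 a) aQ => -[].
rewrite -(setD1K aQ); apply: (@extend_stage (Q :\ a) a [::] T) => //.
- by rewrite !inE eqxx.
- by rewrite setD1K // => i /(subsetP sQ)/imsetP[e _ ->].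
by rewrite /reached !big_nil setU0 cards1.
Qed.

End AcyclicTransversal.

(** * Edge colourings of bipartite graphs *)

Lemma leq_card_iota (E : finType) (A : {set E}) (f : E -> nat) m n :
  {in A &, injective f} -> {in A, forall e, m <= f e < m + n} -> #|A| <= n.
Proof.
move=> fI fA; rewrite cardE -(size_map f) -(size_iota m n).
apply: uniq_leq_size => [|k /mapP[e]].
  by rewrite map_inj_in_uniq ?enum_uniq // => x y; rewrite !mem_enum; apply: fI.
by rewrite mem_enum => /fA fe ->; rewrite mem_iota.
Qed.

Section Konig.
Variables (E : finType) (X Y : eqType) (a : E -> X) (b : E -> Y).
Implicit Types (F : {set E}) (c : E -> nat).

Definition proper F c := {in F &, forall e e',
  c e = c e' -> (a e == a e') || (b e == b e') -> e = e'}.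

Lemma missing_color (Z : eqType) (f : E -> Z) F c d z :
  #|[set e in F | f e == z]| < d ->
  exists2 i, i < d & {in F, forall e, f e = z -> c e != i}.
Proof.
set A := [set e in F | _] => ltA.
have /allPn[i] : ~~ all (mem (map c (enum A))) (iota 0 d).
  apply: contraL ltA => /allP sub; rewrite -leqNgt cardE -(size_map c).
  by rewrite -[leqLHS](size_iota 0); apply: uniq_leq_size sub; apply: iota_uniq.
rewrite mem_iota => /andP[_ lti] iA; exists i => // e eF fe.
by apply: contraNneq iA => <-; apply: map_f; rewrite mem_enum inE eF fe eqxx.
Qed.

(** Frees [i] at both ends of [e0], the edge to be coloured next. If [i] occurs at [b e0], then [i]
    and [j] are exchanged on the Kempe chain starting there. The chain arrives on the [a] side by
    edges of colour [i] only, so it avoids [a e0]. *)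
Lemma kempe_swap F c i j e0 : proper F c ->
  {in F, forall e, a e = a e0 -> c e != i} ->
  {in F, forall e, b e = b e0 -> c e != j} ->
  exists2 c', proper F c' &
    {in F, forall e, (a e == a e0) || (b e == b e0) -> c' e != i}
    /\ {in F, forall e, c' e \in [:: c e; i; j]}.
Proof.
move=> prc ai bj; case: (boolP [exists g in F, (c g == i) && (b g == b e0)]);
  last first.
  move=> none; exists c => //; split=> [e eF /orP[/eqP|be]|e _].
  - exact: ai.
  - by apply: contraNneq none => ci; apply/exists_inP; exists e;
      rewrite ?ci ?eqxx.
  by rewrite mem_head.
case/exists_inP=> g0 g0F /andP[/eqP cg0 /eqP bg0].
have ij : i != j by rewrite -cg0; apply: bj.
(* The chain is followed along its edges of colour [i], collected in [R]; consecutive ones are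
   joined by an edge of colour [j]. [K] is the whole chain. *)
pose step g g' := [&& g' \in F, c g' == i &
  [exists h in F, [&& c h == j, a h == a g & b h == b g']]].
pose R := connect step g0.
have RF g : R g -> g \in F /\ c g = i.
  case/connectP=> p; elim/last_ind: p => [_ -> //|p h _].
  by rewrite rcons_path last_rcons => /andP[_ /and3P[hF /eqP ch _]] ->.
pose K e := (c e == i) && R e || (c e == j) && [exists g, R g && (a g == a e)].
have KR e : c e = i -> K e -> R e by rewrite /K => ->;
  rewrite eqxx (negPf ij) orbF.
have KS e : c e = j -> K e -> exists2 g, R g & a g = a e.
  rewrite /K => ->; rewrite eq_sym (negPf ij) eqxx =>
    /existsP[g /andP[Rg /eqP]].
  by exists g.
have RK e : R e -> K e by move=> Re; rewrite /K; case: (RF e Re) => _ ->;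
  rewrite eqxx Re.
have SK e g : R g -> a g = a e -> c e = j -> K e.
  by move=> Rg ag ce; rewrite /K ce eqxx; apply/orP/or_intror/existsP;
    exists g; rewrite Rg ag /=.
(* The chain is a full component of colours [i] and [j], so the exchange stays proper. At its first
   vertex this holds because [j] is missing at [b e0]. *)
have closedK e e' : e \in F -> e' \in F -> (a e == a e') || (b e == b e') ->
  K e ->
    (c e = i /\ c e' = j) \/ (c e = j /\ c e' = i) -> K e'.
  move=> eF e'F adj Ke [[ce ce']|[ce ce']].
    have Re := KR e ce Ke; case/orP: adj => [/eqP ae|/eqP be];
      first exact: SK Re ae ce'.
    case/connectP: (Re) => p; elim/last_ind: p => [_ eg|p h _].
      by have := bj e' e'F; rewrite -be eg /= => /(_ bg0); rewrite ce' eqxx.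
    rewrite rcons_path last_rcons => /andP[pp st] eh.
    case/and3P: st => _ _ /exists_inP[k kF /and3P[/eqP ck /eqP ak /eqP bk]].
    have -> : e' = k by apply: prc; rewrite ?ck // bk -eh -be eqxx orbT.
    apply: (SK _ (last g0 p)) => //; apply/connectP; by exists p.
  have [g Rg ag] := KS e ce Ke; have [gF cg] := RF g Rg.
  case/orP: adj => [/eqP ae|/eqP be].
    have -> : e' = g by apply: prc; rewrite ?cg // ag ae eqxx.
    exact: RK.
  apply: RK; apply: connect_trans Rg _; apply: connect1;
    rewrite /step e'F ce' eqxx.
  by apply/exists_inP; exists e; rewrite ?ce ?ag ?be ?eqxx.
pose sw k := if k == i then j else if k == j then i else k.
have swI : injective sw.
  by move=> k l; rewrite /sw; move/eqP: ij; do 4?case: eqP; lia.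
have Kij e : K e -> c e = i \/ c e = j.
  by case/orP=> /andP[/eqP]; [left | right].
have swij e e' : K e -> sw (c e) = c e' ->
  (c e = i /\ c e' = j) \/ (c e = j /\ c e' = i).
  move=> Ke <-; rewrite /sw; case: (Kij e Ke) => ->; rewrite eqxx;
    first by left.
  by rewrite eq_sym (negPf ij); right.
exists (fun e => if K e then sw (c e) else c e).
  move=> e e' eF e'F; case: (boolP (K e)) => Ke; case: (boolP (K e')) => Ke'.
  - by move/swI; apply: prc.
  - by move=> /(swij _ _ Ke) cc adj; case/negP: Ke'; apply: closedK Ke cc.
  - move/esym => /(swij _ _ Ke') cc adj; case/negP: Ke;
      apply: closedK Ke' cc => //.
    by rewrite !(eq_sym _ (a e), eq_sym _ (b e)).
  exact: prc.
split=> e eF; last first.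
  case: ifP => _; rewrite /sw ?mem_head // !inE.
  by do 2?case: ifP => _; rewrite eqxx ?orbT.
case: (boolP (K e)) => [Ke|nK] adj; last first.
  case/orP: adj => [/eqP|/eqP be]; first exact: ai.
  apply: contraNneq nK => ci; apply: RK.
  have -> : e = g0 by apply: prc; rewrite ?ci // be bg0 eqxx orbT.
  exact: connect0.
apply/eqP=> swi; have [[ce _]|[cj _]] := swij e g0 Ke (etrans swi (esym cg0)).
  by move: swi; rewrite /sw ce eqxx => ji; rewrite ji eqxx in ij.
case/orP: adj => /eqP; last by move=> be; have := bj e eF be; rewrite cj eqxx.
have [g Rg ag] := KS e cj Ke; have [gF cg] := RF g Rg.
by rewrite -ag => /(ai g gF); rewrite cg eqxx.
Qed.

Theorem konig_edge_coloring F d :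
  (forall x, #|[set e in F | a e == x]| <= d) ->
  (forall y, #|[set e in F | b e == y]| <= d) ->
  exists2 c, {in F, forall e, c e < d} & proper F c.
Proof.
have [n] := ubnP #|F|; elim: n F => // n IHn F ltF ad bd.
case: (set_0Vmem F) => [->|[e0 e0F]]; first by exists (fun=> 0) => x;
  rewrite inE.
pose F' := F :\ e0.
have sub (P : pred E) : [set e in F' | P e] \subset [set e in F | P e].
  by apply/subsetP=> e; rewrite !inE => /andP[/andP[_ ->]].
have lt (P : pred E) k : P e0 -> #|[set e in F | P e]| <= k ->
  #|[set e in F' | P e]| < k.
  move=> Pe0; apply: leq_trans; apply: proper_card;
    rewrite properEneq sub andbT.
  by apply/eqP=> /setP/(_ e0); rewrite !inE eqxx e0F Pe0.
have [|x|y|c cd prc] := IHn F'.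
- by move: ltF; rewrite (cardsD1 e0 F) e0F.
- exact: leq_trans (subset_leq_card (sub _)) (ad x).
- exact: leq_trans (subset_leq_card (sub _)) (bd y).
have [i id ai] := missing_color c (lt _ _ (eqxx (a e0)) (ad (a e0))).
have [j jd bj] := missing_color c (lt _ _ (eqxx (b e0)) (bd (b e0))).
have [c' prc' [ci cc]] := kempe_swap prc ai bj.
exists (fun e => if e == e0 then i else c' e).
  move=> e eF; case: eqVneq => // ee0.
  have eF' : e \in F' by rewrite !inE ee0.
  by move: (cc e eF') (cd e eF'); rewrite !inE => /or3P[]/eqP->.
move=> e e' eF e'F; case: (eqVneq e e0) => [->|ee0];
  case: (eqVneq e' e0) => [->|ee0'] //.
- have eF' : e' \in F' by rewrite !inE ee0'.
  move=> iE; rewrite (eq_sym (a _)) (eq_sym (b _)) => /(ci e' eF').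
  by rewrite -iE eqxx.
- have eF' : e \in F' by rewrite !inE ee0.
  by move=> iE /(ci e eF'); rewrite iE eqxx.
by apply: prc'; rewrite !inE ?ee0 ?ee0'.
Qed.

End Konig.

(* The heads of the edges entering [v] are split into [g v] blocks of [d], so
   that every vertex of the resulting bipartite graph has degree at most [d]. *)
Lemma balanced_coloring (E V : finType) (tail head : E -> V) (F : {set E})
    (d : nat) (g : V -> nat) :
  (forall v, #|[set e in F | tail e == v]| <= d) ->
  (forall v, #|[set e in F | head e == v]| <= d * g v) ->
  exists c : E -> nat, [/\ {in F, forall e, c e < d},
    {in F &, forall e e', c e = c e' -> tail e = tail e' -> e = e'}
    & forall i v, #|[set e in F | (head e == v) && (c e == i)]| <= g v].
Proof.
move=> td hd.
pose idx e := index e (enum [set e' in F | head e' == head e]).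
pose b e := (head e, idx e %/ d).
have idxI e e' : e \in F -> e' \in F -> head e = head e' -> idx e = idx e' ->
  e = e'.
  move=> eF e'F he; rewrite /idx -he => ie.
  by apply: (index_inj e _ _ ie); rewrite mem_enum inE ?eF ?e'F ?he eqxx.
have d_gt0 e : e \in F -> 0 < d.
  move=> eF; apply: leq_trans (td (tail e)); apply/card_gt0P; exists e.
  by rewrite inE eF eqxx.
have bd y : #|[set e in F | b e == y]| <= d.
  case: y => v j; apply: (@leq_card_iota _ _ idx (j * d)) => [e e'|e].
    rewrite !inE => /andP[eF /eqP[he _]] /andP[e'F /eqP[he' _]].
    by apply: idxI; rewrite ?he.
  rewrite inE => /andP[eF /eqP[_ <-]]; have dg := d_gt0 e eF.
  by rewrite leq_trunc_div /= addnC -mulSn -ltn_divLR.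
have [c cd prc] := konig_edge_coloring td bd.
exists c; split=> // [e e' eF e'F cc te|i v].
  by apply: prc; rewrite ?te ?eqxx.
(* Edges of colour [i] entering [v] lie in distinct blocks, numbered below [g v]. *)
apply: (@leq_card_iota _ _ (fun e => idx e %/ d) 0) => [e e'|e].
  rewrite !inE => /and3P[eF /eqP he /eqP ce] /and3P[e'F /eqP he' /eqP ce'] ee.
  by apply: prc; rewrite ?ce // /b he he' ee eqxx orbT.
rewrite inE => /and3P[eF /eqP he _]; rewrite /= add0n ltn_divLR ?(d_gt0 e) //.
rewrite mulnC; apply: leq_trans (hd v); rewrite /idx he cardE index_mem.
by rewrite mem_enum inE eF he eqxx.
Qed.

(** * Orientations *)

Section Orientation.
Variable T : finType.
Implicit Types (G H : sgraph T) (D : {set T * T}).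

Definition outdeg D v := #|[set w | (v, w) \in D]|.
Definition indeg D v := #|[set u | (u, v) \in D]|.

Definition orients G D := forall x y,
  G x y = ((x, y) \in D) || ((y, x) \in D) /\ ((x, y) \in D -> (y, x) \notin D).

Lemma orients_degree G D v : orients G D -> degree G v = outdeg D v + indeg D v.
Proof.
move=> oD; rewrite /degree /outdeg /indeg -cardsUI.
set I := _ :&: _; have -> : I = set0.
  apply/setP=> w; rewrite !inE; apply/negP=> /andP[vw].
  by apply/negP; have [_] := oD v w; apply.
rewrite cards0 addn0; apply: eq_card => w; rewrite !inE.
by have [-> _] := oD v w.
Qed.

(** Otherwise each vertex of [X] has two neighbours in [X]. A path in [X] can then always be
    extended at its first vertex, as returning to the path would close a cycle, and it outgrows
    [T]. *)
Lemma forest_leaf H (X : {set T}) : is_forest H -> X != set0 ->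
  exists2 v, v \in X & #|[set w in X | H v w]| <= 1.
Proof.
move=> /is_forestP noc /set0Pn[v0 v0X].
apply/exists_inP; apply: contraT => /exists_inPn deg.
suff long n : exists x p, [/\ size p = n, path H x p, uniq (x :: p) & {subset x
  :: p <= X}].
  have [x [p [sp _ /card_uniqP cp _]]] := long #|T|.
  by have := max_card (mem (x :: p)); rewrite cp /= sp ltnn.
elim: n => [|n [x [p [sp xp up pX]]]].
  by exists v0, [::]; split=> // y; rewrite inE => /eqP->.
have := deg x (pX x (mem_head _ _)); rewrite -ltnNge.
(* [head x p] is the second vertex of the path, or [x] for a trivial path; in both cases another
   neighbour remains. *)
rewrite (cardsD1 (head x p)) -ltnS => ltd.
have /set0Pn[y] : [set w in X | H x w] :\ head x p != set0.
  by rewrite -card_gt0; move: ltd; case: (_ \in _); lia.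
rewrite !inE => /and3P[yh yX xy].
have yx : y != x by apply: contraTneq xy => ->; rewrite adj_irr.
case: (boolP (y \in p)) => [yp|yNp]; last first.
  exists y, (x :: p); split; rewrite /= ?sp //.
  - by rewrite adj_sym xy.
  - by rewrite inE negb_or yx yNp.
  - by move=> z; rewrite inE => /orP[/eqP->//|/pX].
case: p sp xp up pX yh yp {ltd} => // z p _ xp up _ /= yz.
rewrite inE (negPf yz) /= => /splitPr yp; case: yp xp up => p1 p2 xp up.
have /andP[uC _] : uniq (x :: z :: rcons p1 y) && uniq p2.
  move: up; rewrite -cat_rcons -[x :: _]/((x :: z :: rcons p1 y) ++ p2)
    cat_uniq.
  by case/and3P=> -> _ ->.
case/negP: (noc (x :: z :: rcons p1 y)); rewrite /is_cycle /ucycleb uC /=.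
rewrite size_rcons !andbT; move: xp; rewrite -cat_rcons /= cat_path.
by case/and3P=> -> p1y _; rewrite rcons_path p1y last_rcons adj_sym xy.
Qed.

(** Leaves are stripped one by one, and the edge joining a leaf to the remaining vertices is
    directed away from the leaf. *)
Lemma forest_orientation H : is_forest H ->
  exists2 D, orients H D & forall v, outdeg D v <= 1.
Proof.
move=> Hf; suff or_in n : forall X : {set T}, #|X| = n ->
  exists2 D : {set T * T},
    forall x y, (H x y && [&& x \in X & y \in X] = ((x, y) \in D) || ((y, x)
      \in D)) /\
      ((x, y) \in D -> (y, x) \notin D) & forall v, outdeg D v <= 1.
  have [D oD D1] := or_in _ setT erefl; exists D => // x y.
  by have := oD x y; rewrite !in_setT !andbT.
elim: n => [X /cards0_eq -> | n IHn X cX].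
  exists set0 => [x y|v]; first by rewrite !inE /=; split=> //; apply: andbF.
  by rewrite /outdeg -[leqRHS](@cards1 T v) subset_leq_card //;
    apply/subsetP=> w; rewrite !inE.
have X0 : X != set0 by rewrite -card_gt0 cX.
have [v vX v1] := forest_leaf Hf X0.
have [|D oD D1] := IHn (X :\ v); first by move: cX;
  rewrite (cardsD1 v) vX => -[].
have DX x y : (x, y) \in D -> [/\ H x y, x \in X :\ v & y \in X :\ v].
  by move=> xy; have [] := oD x y; rewrite xy => /and3P[].
pose A := [set e : T * T | [&& e.1 == v, e.2 \in X & H v e.2]].
exists (D :|: A) => [x y|u]; last first.
  case: (eqVneq u v) => [->|uv].
    apply: leq_trans v1; apply/subset_leq_card/subsetP=> w.
    rewrite !inE /= eqxx => /orP[/DX[_]|//]; by rewrite !inE eqxx.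
  apply: leq_trans (D1 u); apply/subset_leq_card/subsetP=> w.
  by rewrite !inE /= (negPf uv) orbF.
have [Exy Dxy] := oD x y; have vv : H v v = false by apply: adj_irr.
move: Exy; rewrite !inE /=.
have nD w : ((v, w) \in D = false) * ((w, v) \in D = false).
  by split; apply/negP=> /DX[_]; rewrite !inE eqxx.
case: (eqVneq x v) => [xv|xv]; case: (eqVneq y v) => [yv|yv] //=; subst;
  rewrite ?nD ?vv ?vX ?orbF //=.
- by move=> _; rewrite andbC.
- by move=> _; split=> //; rewrite adj_sym andbC andbT.
Qed.

(** Reversal moves one unit of indegree from the last vertex to the first. The additive equation
    avoids subtraction and covers the trivial path. *)
Lemma reverse_path G D x p : orients G D ->
  path (fun u v => (u, v) \in D) x p ->
  uniq (x :: p) -> exists2 D', orients G D' &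
  forall v, indeg D' v + (v == last x p) = indeg D v + (v == x).
Proof.
elim: p x D => [|y p IHp] x D oD /=; first by exists D.
case/andP=> xyD yp /andP[xN up].
pose D1 := (y, x) |: D :\ (x, y).
have xy : x != y by apply: contraNneq xN => ->; rewrite mem_head.
have yxN : (y, x) \notin D by have [_ ->] := oD x y.
have oD1 : orients G D1.
  move=> u v; have [-> uv] := oD u v; rewrite !inE !xpair_eqE.
  case: (eqVneq u x) => [ux|ux]; case: (eqVneq v y) => [vy|vy] /=;
  case: (eqVneq u y) => [uy|uy]; case: (eqVneq v x) => [vx|vx] //=; subst;
    rewrite ?xyD ?(negPf yxN) ?eqxx ?orbT ?orbF //; try by rewrite ?eqxx in xy.
have ypD1 : path (fun u v => (u, v) \in D1) y p.
  apply: (@sub_in_path _ (mem (y :: p)) _ _ _ _ _ _ yp) => [u v|];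
    last exact/allP.
  rewrite !inE => uyp vyp ->; rewrite andbT !xpair_eqE negb_and.
  by rewrite (_ : u != x) ?orbT //; apply: contraNneq xN => <-; rewrite inE.
have [D' oD' iD'] := IHp y D1 oD1 ypD1 up; exists D' => // v.
rewrite iD' /indeg.
case: (eqVneq v y) => [->|vy].
  rewrite eq_sym (negPf xy) addn0 (cardsD1 x [set u | (u, y) \in D]) inE xyD
    addnC.
  congr (_ + _); apply: eq_card => u; rewrite !inE !xpair_eqE eqxx andbT.
  by rewrite (eq_sym y) (negPf xy) andbF.
case: (eqVneq v x) => [->|vx].
  rewrite addn0 (cardsD1 y [set u | (u, x) \in D1]) !inE eqxx addnC /=.
  congr (_ + _); apply: eq_card => u;
    rewrite !inE !xpair_eqE eqxx andbT (negPf xy) andbF /=.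
  by case: eqVneq => //= ->; rewrite (negPf yxN).
rewrite !addn0; apply: eq_card => u.
by rewrite !inE !xpair_eqE (negPf vx) (negPf vy) !andbF.
Qed.

Lemma balanced_orientation G D d (f : T -> nat) : orients G D ->
  (forall v, outdeg D v <= d) -> (forall v, 2 <= f v) ->
  (forall v, degree G v <= d * f v) ->
  exists2 D', orients G D' &
    (forall v, outdeg D' v <= d) /\ (forall v, indeg D' v <= d * (f v).-1).
Proof.
move=> + + f2 df; have [n] := ubnP (\sum_v (indeg D v - d * (f v).-1)).
elim: n D => // n IHn D ltn oD outD.
case: (boolP [forall v, indeg D v <= d * (f v).-1]) => [/forallP inD|].
  by exists D.
case/forallPn=> v; rewrite -ltnNge => inv.
pose r := fun u v => (u, v) \in D.
pose X := [set u | connect r u v].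
have [w wX inw] : exists2 w, w \in X & indeg D w < d * (f w).-1.
  (* As [f w] is at least 2, each bound [d * (f w).-1] is at least [d]; the indegrees in [X] would
     sum to more than [d * #|X|], although all edges into [X] start in [X]. *)
  apply/exists_inP; apply: contraT => /exists_inPn big.
  have vX : v \in X by rewrite inE connect0.
  have cl u w : w \in X -> (u, w) \in D -> u \in X.
    rewrite !inE => wv uw; apply: connect_trans wv; exact: connect1.
  have : \sum_(w in X) indeg D w <= d * #|X|.
    have -> : \sum_(w in X) indeg D w = \sum_(u in X) \sum_(w in X | (u, w) \in
      D) 1.
      rewrite (exchange_big_dep (mem X)) /=; last by move=> u w _ /andP[].
      apply: eq_bigr => w wX; rewrite /indeg -sum1_card; apply: eq_bigl => u.
      rewrite [LHS]in_set wX /=; apply/idP/andP => [uw|[] //]; split=> //.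
      exact: cl wX uw.
    rewrite mulnC -sum_nat_const; apply: leq_sum => u uX;
      apply: leq_trans (outD u).
    rewrite /outdeg -sum1_card; rewrite [leqRHS](bigID (mem X)) /=.
    apply: leq_trans (leq_addr _ _); apply: eq_leq; apply: eq_bigl => w.
    by rewrite !inE andbC.
  rewrite leqNgt => /negP[]; rewrite (bigD1 v) //=.
  rewrite (cardsD1 v) vX mulnDr muln1 -addSn; apply: leq_add.
    by apply: leq_ltn_trans inv; rewrite leq_pmulr //; have := f2 v; lia.
  rewrite mulnC -sum_nat_const [leqLHS](eq_bigl (fun i =>
    (i \in X) && (i != v))).
    apply: leq_sum => u /andP[/big]; rewrite -leqNgt => le _;
      apply: leq_trans le.
    by rewrite leq_pmulr //; have := f2 u; lia.
  by move=> u; rewrite !inE andbC.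
have wv : w != v by apply: contraTneq inw => ->; rewrite -leqNgt ltnW.
case/connectP: (etrans (esym (in_set _ _)) wX) => p0 wp0 lp0.
case: (shortenP wp0) lp0 => p wp up _ lp.
have [D' oD' iD'] := reverse_path oD wp up; rewrite -lp in iD'.
have iv : indeg D' v + 1 = indeg D v by have := iD' v;
  rewrite eqxx eq_sym (negPf wv) addn0.
have iw : indeg D' w = indeg D w + 1 by have := iD' w;
  rewrite eqxx (negPf wv) addn0.
have iu u : u != v -> u != w -> indeg D' u = indeg D u.
  by move=> uv uw; have := iD' u; rewrite (negPf uv) (negPf uw) !addn0.
apply: (IHn D') => // [|u].
  rewrite ltnS in ltn; apply: leq_trans ltn.
  rewrite (bigD1 v) //= [ltnRHS](bigD1 v) //= -addSn leq_add //;
    first by move: iv inv; lia.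
  apply: leq_sum => u uv; case: (eqVneq u w) => [->|uw]; last by rewrite iu.
  by rewrite iw; move: inw; lia.
(* The outdegree grows only at [v], where the indegree is still at least [d * (f v).-1] and the
   degree is at most [d * f v]. *)
have du := orients_degree u oD; have du' := orients_degree u oD'.
have := outD u; case: (eqVneq u v) => [uv|uv].
  rewrite uv in du du' *; have := df v; move: iv inv (f2 v).
  case: (f v) => // k; rewrite /= mulnS; lia.
by case: (eqVneq u w) => [uw|uw];
  [rewrite uw in du du' * | have := iu u uv uw]; lia.
Qed.

End Orientation.

(** * Circuits *)

Lemma next_next_neq (T : eqType) (p : seq T) x :
  uniq p -> 3 <= size p -> x \in p -> next p (next p x) != x.
Proof.
move=> up sp xp; have [i q rp] := rot_to xp.
have := rot_uniq i p; rewrite -!(next_rot i up) rp up.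
have : size (x :: q) = size p by rewrite -rp size_rot.
case: q {rp} => [|y [|z q]] sq; try by rewrite -sq in sp.
rewrite /= eqxx !inE !negb_or => /and3P[/and3P[xy xz _] _ _].
by rewrite (eq_sym y) (negPf xy) eqxx eq_sym.
Qed.

Section Digraph.
Variable T : finType.
Implicit Types (G H : sgraph T) (D R S : {set T * T}).

Definition arrow D : rel T := fun x y => (x, y) \in D.

Definition functional D := forall x y z, arrow D x y -> arrow D x z -> y = z.

Lemma functional_outdeg D : functional D <-> forall v, outdeg D v <= 1.
Proof.
split=> [fD v|oD x y z xy xz].
  by apply/card_le1_eqP=> x y; rewrite !inE => vx vy; exact: fD vy vx.
by apply: (card_le1_eqP (oD x)); rewrite inE.
Qed.

Definition circuit_free D := forall x y, arrow D x y ->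
  ~~ connect (arrow D) y x.

(** A cycle of [H] is a circuit in one of its two directions: after an edge pointing backwards, the
    next one must point backwards too, since the vertex they share has outdegree at most 1. *)
Lemma circuit_free_forest H D :
  orients H D -> functional D -> circuit_free D -> is_forest H.
Proof.
move=> oD fD aD; apply/is_forestP=> p; apply/negP=> /andP[/andP[Hp up] sp].
have free q : q != [::] -> ~~ cycle (arrow D) q.
  case: q => // x q _; apply/negP=> cq; have := connect_cycle cq.
  have xq : x \in x :: q by apply: mem_head.
  have := next_cycle cq xq => xn /(_ _ _ (_ : next (x :: q) x \in x :: q) xq).
  by rewrite mem_next xq => /(_ isT); apply/negP/aD.
have p0 : p != [::] by case: p sp {Hp up}.
case: (boolP [exists x in p, arrow D (next p x) x]) =>
  [/exists_inP[x xp nx]|none].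
  have back n : let y := iter n (next p) x in y \in p /\ arrow D (next p y) y.
    elim: n => [|n [yp ny]] //=; set y := iter n _ _ in yp ny *.
    rewrite mem_next; split=> //.
    have := next_cycle Hp (_ : next p y \in p); rewrite mem_next => /(_ yp).
    have [-> _] := oD (next p y) (next p (next p y)).
    case/orP=> // ynn; case/eqP: (next_next_neq up sp yp); exact: fD ynn ny.
  have rp0 : rev p != [::] by rewrite -size_eq0 size_rev; case: (size p) sp.
  case/negP: (free _ rp0).
  rewrite rev_cycle; apply: cycle_from_next => // y yp.
  have /iter_findex <- : fconnect (next p) x y.
    by apply: (connect_cycle (cycle_next up)).
  by case: (back (findex (next p) x y)).
case/negP: (free p p0); apply: cycle_from_next => // x xp.
have [Hx _] := oD x (next p x); move: (next_cycle Hp xp); rewrite Hx.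
by case/orP=> // nx; case/negP: none; apply/exists_inP; exists x.
Qed.

Lemma functional_path D x p q : functional D ->
  path (arrow D) x p -> path (arrow D) x q -> size p <= size q ->
  exists s, q = p ++ s.
Proof.
move=> fD; elim: p x q => [x q _ _ _|y p IHp x [|z q]] //=; first by exists q.
case/andP=> xy yp /andP[xz zq] spq; have eyz := fD _ _ _ xy xz; subst z.
by have [s ->] := IHp y q yp zq spq; exists s.
Qed.

(** Of two simple paths from [v] to its predecessors one is a prefix of the other. If the prefix
    were proper, the longer path would continue from it to [v], which cannot recur. *)
Lemma functional_pred D u u' v : functional D -> arrow D u v -> arrow D u' v ->
  connect (arrow D) v u -> connect (arrow D) v u' -> u = u'.
Proof.
move=> fD; have half p q : path (arrow D) v p -> path (arrow D) v q ->
    uniq (v :: q) -> size p <= size q -> arrow D (last v p) v ->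
    last v p = last v q.
  move=> vp vq uq spq pv; have [s eq] := functional_path fD vp vq spq.
  move: vq uq; rewrite eq cat_path last_cat; case: s {eq} => //= w s.
  case/and3P=> _ pw _; rewrite (fD _ _ _ pw pv).
  by rewrite mem_cat mem_head orbT.
move=> uv u'v /connectP[p0 /shortenP[p vp up _] lp].
move=> /connectP[q0 /shortenP[q vq uq _] lq]; subst u u'.
have [spq|/ltnW spq] := leqP (size p) (size q); first exact: half.
by symmetry; apply: half.
Qed.

(** By functionality the walk of [R] from [x] to [u] follows the supposed circuit of [R :\: S],
    whose edge leaving [u] is then [(u, v)] itself. *)
Lemma circuit_free_diff R S : functional R ->
  (forall x y, arrow R x y -> connect (arrow R) y x -> exists u v,
    [/\ (u, v) \in S, arrow R u v & connect (arrow R) x u]) ->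
  circuit_free (R :\: S).
Proof.
move=> fR hit x y; set r := arrow (R :\: S) => xy; apply/negP=> yx.
have sub : subrel r (arrow R) by move=> a b; rewrite /r /arrow inE => /andP[].
have subc a b : connect r a b -> connect (arrow R) a b.
  by apply: connect_sub => ? ? /sub; apply: connect1.
have [u [v [uvS uv]]] := hit x y (sub _ _ xy) (subc _ _ yx).
case/connectP=> p; elim: p x y xy yx => [x y xy yx _ eux|z p IHp x y xy yx].
  move: xy; rewrite /= in eux; rewrite -eux => xy.
  have := fR _ _ _ uv (sub _ _ xy) => vy.
  by move: xy; rewrite /r /arrow inE -vy uvS.
case/andP=> xz zp lp; have yz := fR _ _ _ (sub _ _ xy) xz; subst y.
case/connectP: yx => [[|w q]] /=; first by move=> _ xz'; subst z;
  apply: (IHp x x xy _ zp lp).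
case/andP=> zw wq lq; apply: (IHp z w zw) => //.
by apply: connect_trans (connect1 xy); apply/connectP; exists q.
Qed.

(** For functional [R] and [e] on a circuit, this is the edge set of that circuit. Being the same
    for all its edges, it can serve as the label of their part. *)
Definition circuit_of R (e : T * T) : {set T * T} := [set e' in R |
  connect (arrow R) e.2 e'.1 && connect (arrow R) e'.2 e.1].

Lemma circuit_ofE R e e' : arrow R e.1 e.2 -> e' \in circuit_of R e ->
  circuit_of R e' = circuit_of R e /\ connect (arrow R) e'.2 e'.1.
Proof.
move=> re; rewrite inE => /and3P[e'R c1 c2].
have re' : arrow R e'.1 e'.2 by rewrite /arrow -surjective_pairing.
have c3 : connect (arrow R) e'.2 e.2 by apply: connect_trans (connect1 re).
have c4 : connect (arrow R) e.1 e'.1 by apply: connect_trans c1;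
  apply: connect1.
split; last by apply: connect_trans c1.
apply/setP=> x; rewrite !inE; congr (_ && _); apply/andP/andP=> -[h1 h2]; split.
- by apply: connect_trans h1; apply: connect_trans c1 _; apply: connect1.
- by apply: connect_trans h2 _; apply: connect_trans c2; apply: connect1.
- exact: connect_trans h1.
- exact: connect_trans c4.
Qed.

(** A simple path from [e.2] back to [e.1] gives a cycle of [G]; it has at least 3 vertices because
    [D] holds no edge in both directions. *)
Lemma circuit_of_size G D R e k : orients G D -> R \subset D ->
  (forall p, is_cycle G p -> k <= size p) ->
  arrow R e.1 e.2 -> connect (arrow R) e.2 e.1 -> k <= #|circuit_of R e|.
Proof.
move=> oD RD big; case: e => x y /= xy /connectP[p0 /shortenP[p yp up _] lp].
have cR : cycle (arrow R) (y :: p) by rewrite /= rcons_path yp -lp.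
have RG u v : arrow R u v -> G u v.
  by move/(subsetP RD); have [-> _] := oD u v => ->.
have Gp : is_cycle G (y :: p).
  rewrite /is_cycle /ucycleb up andbT (sub_cycle RG cR) /=.
  case: p yp lp {up cR} => [_ xy'|z [|? ?]] //=.
    by have := RG _ _ xy; rewrite xy' adj_irr.
  rewrite andbT => yz xz; have [_ /(_ (subsetP RD _ xy))] := oD x y.
  by rewrite xz (subsetP RD _ yz).
apply: leq_trans (big _ Gp) _.
rewrite cardE -(size_map (fun z => (z, next (y :: p) z)) (y :: p)).
apply: uniq_leq_size; first by rewrite map_inj_uniq // => ? ? [].
move=> e /mapP[z zp ->]; rewrite mem_enum inE /=.
have yin := mem_head y p; have xin : x \in y :: p by rewrite lp mem_last.
apply/and3P; split; first exact: (next_cycle cR).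
  exact: (connect_cycle cR).
apply: (connect_cycle cR) => //; rewrite -[next_at _ _ _ _]/(next (y :: p) z).
by rewrite mem_next.
Qed.

(** * Passing between edge colourings and orientations *)

Lemma orientation_coloring G D k (col : T * T -> nat) : orients G D ->
  {in D, forall e, col e < k} -> exists c : {ffun edge G -> 'I_k},
  forall i, orients (color_class c i) [set e in D | col e == i].
Proof.
move=> oD colk.
have ex (a : edge G) : exists i : 'I_k, exists e,
    [/\ e \in D, val a = [set e.1; e.2] & col e = i].
  case: a => A /=; rewrite inE => /existsP[x /existsP[y /andP[]]].
  have [-> _] := oD x y => /orP[]xyD /eqP->.
    by exists (Ordinal (colk _ xyD)), (x, y).
  by exists (Ordinal (colk _ xyD)), (y, x); rewrite setUC.
have [c cP] := fin_all_exists ex; exists (finfun c) => i x y.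
have ends (e : T * T) u v : [set u; v] = [set e.1;
  e.2] -> G u v -> e = (u, v) \/ e = (v, u).
  case: e => e1 e2 /= E uv; have uNv : u != v by apply: contraTneq uv => ->;
    rewrite adj_irr.
  have := set21 e1 e2; have := set22 e1 e2; rewrite -E.
  have := set21 u v; have := set22 u v; rewrite E.
  move=> /set2P[] h1 /set2P[] h2 /set2P[] h3 /set2P[] h4; subst; auto;
    by rewrite eqxx in uNv.
rewrite !inE; split; last first.
  by case/andP=> xyD _; have [_ /(_ xyD)/negPf->] := oD x y.
apply/existsP/orP=> [[a]|].
  rewrite ffunE => /andP[/eqP va /eqP <-]; have [e [eD ea <-]] := cP a.
  have [Gxy _] := oD x y; have := ends e x y; rewrite -va => /(_ ea).
  have : G x y by apply: (@color_adjW _ _ _ (finfun c) (c a)); apply/existsP;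
    exists a; rewrite va ffunE !eqxx.
  by move=> xy /(_ xy)[ee|ee]; [left | right]; rewrite -ee eD eqxx.
have edgeP u v : (u, v) \in D -> col (u, v) = i ->
  exists a : edge G, val a = [set u; v] /\ c a = i.
  move=> uvD ci; have uvG : G u v by have [-> _] := oD u v; rewrite uvD.
  have A : [set u; v] \in edges G by rewrite inE; apply/existsP; exists u;
    apply/existsP; exists v; rewrite uvG eqxx.
  pose a : edge G := Sub [set u; v] A; exists a; split=> //; apply/val_inj;
    rewrite /= -ci.
  have [e [eD /= ea <-]] := cP a.
  have [ee|ee] := ends _ _ _ ea uvG; first by rewrite ee.
  by have [_ /(_ uvD)] := oD u v; rewrite -ee eD.
case=> /andP[D1 /eqP c1]; have [a [va ca]] := edgeP _ _ D1 c1; exists a.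
  by rewrite va ffunE ca !eqxx.
by rewrite va ffunE ca setUC !eqxx.
Qed.

Lemma forests_orientation G k : forest_colorable G k ->
  exists2 D, orients G D & forall v, outdeg D v <= k.
Proof.
case/existsP=> c /forallP cf.
have [D oD] := fin_all_exists2 (fun i => forest_orientation (cf i)).
move=> outD; exists (\bigcup_i D i) => [x y|v]; last first.
  rewrite /outdeg; have -> : [set w | (v, w) \in \bigcup_i D i] = \bigcup_i
    [set w | (v, w) \in D i].
    by apply/setP=> w; rewrite inE; apply/bigcupP/bigcupP=> -[i _ h]; exists i;
      rewrite ?inE // in h *.
  have : #|\bigcup_i [set w | (v, w) \in D i]| <= \sum_(i < k) 1.
    apply: (big_ind2 (fun (A : {set T}) n => #|A| <= n)) =>
      [|A m B n Am Bn|i _].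
    - by rewrite cards0.
    - by apply: leq_trans (leq_card_setU _ _) _; apply: leq_add.
    exact: outD.
  by rewrite sum1_card card_ord.
have cls i u v : (u, v) \in D i -> color_adj c i u v by have [/= ->
  _] := oD i u v => ->.
split.
  apply/idP/orP=> [xy|[]/bigcupP[i _]/cls/color_adjW] //;
    last by rewrite adj_sym.
  have A : [set x; y] \in edges G by rewrite inE; apply/existsP; exists x;
    apply/existsP; exists y; rewrite xy eqxx.
  pose a : edge G := Sub [set x; y] A.
  have : color_adj c (c a) x y by apply/existsP; exists a; rewrite !eqxx.
  have [/= -> _] := oD (c a) x y.
  by case/orP=> h; [left | right]; apply/bigcupP; exists (c a).
case/bigcupP=> i _ xyi; apply/negP=> /bigcupP[j _ yxj].
have [_ /(_ xyi)] := oD i x y.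
suff -> : i = j by rewrite yxj.
have /existsP[a /andP[/eqP va /eqP <-]] := cls _ _ _ xyi.
have /existsP[b /andP[/eqP vb /eqP <-]] := cls _ _ _ yxj.
by congr (c _); apply: val_inj; rewrite va vb setUC.
Qed.

End Digraph.

(** * Decomposition into forests *)

Lemma ceil_div_le m n d : 0 < n -> ceil_div m n <= d -> m <= d * n.
Proof.
move=> n_gt0; apply: contraTT; rewrite -!ltnNge => lt.
by rewrite /ceil_div leq_divRL // mulSn; lia.
Qed.

Lemma girth_cycle (T : finType) (G : sgraph T) n p :
  leq_inf n (girth G) -> is_cycle G p -> n <= size p.
Proof.
case g: (girth G) => [m|] /= h cp.
  by have [_ /(_ p cp)] := (girth_Some G m).1 g; apply: leq_trans.
by have /is_forestP/(_ p) := (girth_None G).1 g; rewrite cp.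
Qed.

Section Decomposition.
Variables (T : finType) (G : sgraph T) (D : {set T * T}) (d : nat).
Variables (c : T * T -> nat).
Hypothesis oD : orients G D.
Hypothesis c_lt : {in D, forall e, c e < d}.
Hypothesis c_fun : forall i, functional [set e in D | c e == i].
Hypothesis long : forall p, is_cycle G p -> 4 * d <= size p.

Let R i := [set e in D | c e == i].

Lemma cut_monochromatic_circuits : exists S : {set T * T},
  [/\ S \subset D, {in S &, injective fst}, {in S &, injective snd},
      circuit_free S & forall i, circuit_free (R i :\: S)].
Proof.
have arR e : e \in D -> arrow (R (c e)) e.1 e.2.
  by move=> eD; rewrite /arrow -surjective_pairing inE eD eqxx.
pose on e := (e \in D) && connect (arrow (R (c e))) e.2 e.1.
pose E : finType := {e : T * T | on e}.
pose part (e : E) := circuit_of (R (c (val e))) (val e).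
have ED (e : E) : val e \in D by case/andP: (valP e).
have Eon (e : E) : connect (arrow (R (c (val e)))) (val e).2 (val e).1.
  by case/andP: (valP e).
have cI (P : pred E) : {in [set e | P e] &, injective (c \o val)} ->
    #|[set e | P e]| <= d.
  by move=> cI; apply: (@leq_card_iota _ _ _ 0 d cI) => e _ /=;
    rewrite c_lt ?ED.
have loopless (e : E) : (val e).1 != (val e).2.
  have := ED e; rewrite [val e]surjective_pairing => eD /=.
  have [Ge _] := oD (val e).1 (val e).2.
  by apply/eqP=> h; have := adj_irr G (val e).1; rewrite {2}h Ge eD.
have tail_le v : #|[set e : E | (val e).1 == v]| <= d.
  apply: cI => e e'; rewrite !inE => /eqP te /eqP te' /= cc; apply: val_inj.
  have := arR _ (ED e); have := arR _ (ED e'); rewrite -cc te te' => h' h.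
  have h2 := c_fun h h'; rewrite [val e]surjective_pairing te h2 -te'.
  by rewrite -surjective_pairing.
(* A colour class may have several arcs into [v], but by [functional_pred] only one of them lies on
   a circuit. *)
have head_le v : #|[set e : E | (val e).2 == v]| <= d.
  apply: cI => e e'; rewrite !inE => /eqP te /eqP te' /= cc; apply: val_inj.
  have := arR _ (ED e); have := arR _ (ED e'); rewrite -cc te te' => h' h.
  have := Eon e; have := Eon e'; rewrite -cc te te' => k' k.
  have h1 := functional_pred (@c_fun _) h h' k k'.
  by rewrite [val e]surjective_pairing te h1 -te' -surjective_pairing.
have [|S [tS hS aS] hit] := @acyclic_transversal T E _ (fst \o val) (snd \o val)
  part loopless d tail_le head_le.
  move=> e; have RD : R (c (val e)) \subset D by apply/subsetP=> x;
    rewrite inE => /andP[].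
  apply: leq_trans (circuit_of_size oD RD long (arR _ (ED e)) (Eon e)) _.
  rewrite -(card_imset _ val_inj); apply/subset_leq_card/subsetP=> x xe.
  have [px cx] := circuit_ofE (arR _ (ED e)) xe.
  have := xe; rewrite 2!inE -andbA => /and3P[xD /eqP xc _].
  have ox : on x by rewrite /on xD xc.
  by apply/imsetP; exists (Sub x ox); rewrite // inE /part /= xc px.
exists [set val e | e in S]; split.
- by apply/subsetP=> _ /imsetP[e _ ->].
- by move=> _ _ /imsetP[e eS ->] /imsetP[e' eS' ->] ee; congr val; apply: tS.
- by move=> _ _ /imsetP[e eS ->] /imsetP[e' eS' ->] ee; congr val; apply: hS.
- have eqarc x y : arrow [set val e | e in S] x y = arc_rel (fst \o val) (snd
    \o val) S x y.
    apply/imsetP/arc_relP => [[e eS ee]|[e eS [/= e1 e2]]]; exists e => //=.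
      by rewrite -ee.
    by rewrite -e1 -e2 -surjective_pairing.
  move=> x y; rewrite eqarc (eq_connect eqarc) => /arc_relP[e eS [<- <-]].
  by move/forall_inP: aS; apply.
move=> i; apply: circuit_free_diff (@c_fun i) _ => x y xy yx.
have := xy; rewrite /arrow inE => /andP[xyD /eqP cxy].
have oxy : on (x, y) by rewrite /on xyD cxy.
have [t tinS pt] := hit (Sub (x, y) oxy).
have : val t \in part t by rewrite !inE ED !eqxx Eon.
rewrite pt /part /= cxy inE => /and3P[ti yt _].
exists (val t).1, (val t).2; rewrite /arrow -surjective_pairing; split=> //.
  exact: imset_f.
exact: connect_trans (connect1 xy) yt.
Qed.
End Decomposition.

Theorem theorem6 (T : finType) (G : sgraph T) (f : T -> nat)
  (f_ge2 : forall v : T, 2 <= f v) (d : nat)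
  (def_d : d = maxn (max_degree_ratio G f) (arboricity G))
  (girth_ge : leq_inf (4 * d) (girth G)) :
  deg_arboricity G f_ge2 <= d + 1.
Proof.
have arb_le : arboricity G <= d by rewrite def_d leq_maxr.
have deg_le v : degree G v <= d * f v.
  apply: ceil_div_le; first exact: ltnW.
  rewrite def_d; apply: leq_trans (leq_maxl _ _).
  exact: (leq_bigmax (F := fun v => ceil_div (degree G v) (f v))).
have [D0 oD0 out0] : exists2 D, orients G D & forall v, outdeg D v <= d.
  move: arb_le; rewrite /arboricity;
    case: ex_minnP => k /forests_orientation[D oD outD] _ kd.
  by exists D => // v; apply: leq_trans kd.
have [D oD [outD inD]] := balanced_orientation oD0 out0 f_ge2 deg_le.
have outE v : #|[set e in D | e.1 == v]| = outdeg D v.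
  rewrite /outdeg -[RHS](card_imset _ (_ : injective (pair v)));
    last by move=> ? ? [].
  apply: eq_card => -[u w]; rewrite inE /=;
    apply/andP/imsetP => [[uw /eqP uv]|[w']].
    by exists w; rewrite ?inE -uv.
  by rewrite inE => vw [-> ->]; rewrite eqxx.
have inE' (A : {set T * T}) v : #|[set e in A | e.2 == v]| = indeg A v.
  rewrite /indeg -[RHS](card_imset _ (_ : injective (pair^~ v)));
    last by move=> ? ? [].
  apply: eq_card => -[u w]; rewrite inE /=;
    apply/andP/imsetP => [[uw /eqP wv]|[u']].
    by exists u; rewrite ?inE -wv.
  by rewrite inE => uv [-> ->]; rewrite eqxx.
have [v|v|c [cd c_out c_in]] := @balanced_coloring _ _ fst snd D d (fun v =>
  (f v).-1).
- by rewrite outE.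
- by rewrite inE'.
have c_fun i : functional [set e in D | c e == i].
  move=> x y z; rewrite /arrow !inE => /andP[xy /eqP cxy] /andP[xz /eqP cxz].
  by have [] : (x, y) = (x, z) by apply: c_out; rewrite ?cxy.
have long p : is_cycle G p -> 4 * d <= size p by apply: girth_cycle.
have [S [SD S1 S2 Sf Rf]] := cut_monochromatic_circuits oD cd c_fun long.
(* The colour [d] is new, since [c] stays below [d] on [D]; its class is exactly [S]. *)
pose col e := if e \in S then d else c e.
have col_lt : {in D, forall e, col e < d + 1}.
  by move=> e eD; rewrite /col addn1 ltnS; case: ifP => // _; apply/ltnW/cd.
have [c' oc'] := orientation_coloring oD col_lt.
rewrite /deg_arboricity; case: ex_minnP => k _; apply.
apply/existsP; exists c'; apply/forallP=> i; have oi := oc' i.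
have [Sfun Sdeg] : functional S /\ forall v, indeg S v <= 1.
  split=> [x y z xy xz|v]; first by have [] := S1 _ _ xy xz erefl.
  by apply/card_le1_eqP=> x y; rewrite !inE => xv yv;
    have [] := S2 _ _ yv xv erefl.
have colE : [set e in D | col e == i] = S \/
    [set e in D | col e == i] = [set e in D | c e == i] :\: S.
  case: (eqVneq (i : nat) d) => [->|id]; [left | right]; apply/setP=> e.
    rewrite inE /col; case: ifP => [eS|eS]; first by rewrite eqxx (subsetP SD).
    by apply/andP=> -[eD /eqP ce]; have := cd e eD; rewrite ce ltnn.
  by rewrite !inE /col; case: ifP => //= _; rewrite eq_sym (negPf id) andbF.
apply/andP; split.
  apply: circuit_free_forest oi _ _; case: colE => -> //.
  by move=> x y z; rewrite /arrow !in_setD => /andP[_ xy] /andP[_];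
    apply: c_fun xy.
apply/forallP=> v; rewrite (orients_degree v oi).
(* In [S] the degree is at most [1 + 1], hence at most [f v]; in the other classes it is at most
   [1 + (f v).-1]. *)
case: colE => ->.
  apply: leq_trans (f_ge2 v); rewrite -[2]/(1 + 1); apply: leq_add (Sdeg v).
  by have /functional_outdeg := Sfun.
rewrite -(ltn_predK (f_ge2 v)) -[leqRHS]add1n; apply: leq_add.
  apply: leq_trans (subset_leq_card _) ((functional_outdeg _).1 (c_fun i) v).
  by apply/subsetP=> w; rewrite !inE => /andP[_].
apply: leq_trans (c_in i v); rewrite -inE'; apply/subset_leq_card/subsetP=> e.
by rewrite !inE => /andP[/and3P[_ -> ->] ->].
Qed.
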